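(* For every 3-regular graph $G$, the line graph of $G$ is 4-star colourable if and only if $G$ is bipartite and distance-two 4-colourable.
   Context: Graphs are finite and simple. A $k$-colouring is a map $f\colon V(G)\to\mathbb{Z}_k$ with adjacent vertices receiving distinct colours; a bicoloured component of $(G,f)$ is a connected component of the subgraph induced by two colour classes. A $k$-star colouring is a $k$-colouring in which every bicoloured component is a star $K_{1,q}$ ($q\ge 0$). A distance-two $k$-colouring is a $k$-colouring in which every bicoloured component is $K_1$ or $K_2$ (equivalently, vertices at distance at most 2 receive distinct colours). *)

(* Defs.v *)
From mathcomp Require Import all_boot.
Set Implicit Arguments.
Unset Strict Implicit.
Unset Printing Implicit Defensive.

Record sgraph := SGraph {
  vertex :> finType;
  adj : rel vertex;
  adj_sym : symmetric adj;
  adj_irr : irreflexive adj }.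

Definition regular (d : nat) (G : sgraph) : Prop :=
  forall x : G, #|[set y | adj x y]| = d.

Definition bipartite (G : sgraph) : Prop :=
  exists A : {set G}, forall x y : G, adj x y -> (x \in A) != (y \in A).

Definition isomorphic (G H : sgraph) : Prop :=
  exists2 h : G -> H, bijective h & forall x y : G, adj (h x) (h y) = adj x y.

Section Induced.
Variables (G : sgraph) (A : {set G}).

Definition induced_adj : rel {x : G | x \in A} :=
  fun x y => adj (val x) (val y).

Fact induced_sym : symmetric induced_adj.
Proof. by move=> x y; apply: adj_sym. Qed.

Fact induced_irr : irreflexive induced_adj.
Proof. by move=> x; apply: adj_irr. Qed.

Definition induced : sgraph := SGraph induced_sym induced_irr.
End Induced.

Definition component (G : sgraph) (x : G) : sgraph :=
  induced [set y | connect (@adj G) x y].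

Section Complete.
Variable n : nat.

Definition complete_adj : rel 'I_n := fun x y => x != y.

Fact complete_sym : symmetric complete_adj.
Proof. by move=> x y; rewrite /complete_adj eq_sym. Qed.

Fact complete_irr : irreflexive complete_adj.
Proof. by move=> x; rewrite /complete_adj eqxx. Qed.

Definition complete : sgraph := SGraph complete_sym complete_irr.
End Complete.

(* K_{1,q}: the centre is None, the q leaves are the Some i. *)
Section Star.
Variable q : nat.

Definition star_adj : rel (option 'I_q) :=
  fun x y => (x == None) != (y == None).

Fact star_sym : symmetric star_adj.
Proof. by move=> x y; rewrite /star_adj eq_sym. Qed.

Fact star_irr : irreflexive star_adj.
Proof. by move=> x; rewrite /star_adj eqxx. Qed.

Definition star : sgraph := SGraph star_sym star_irr.
End Star.

Section LineGraph.
Variable G : sgraph.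

Definition edges : {set {set G}} :=
  [set E | [exists x : G, exists y : G, adj x y && (E == [set x; y])]].

Definition line_adj : rel {E : {set G} | E \in edges} :=
  fun E F => (E != F) && (val E :&: val F != set0).

Fact line_sym : symmetric line_adj.
Proof. by move=> E F; rewrite /line_adj eq_sym setIC. Qed.

Fact line_irr : irreflexive line_adj.
Proof. by move=> E; rewrite /line_adj eqxx. Qed.

Definition line_graph : sgraph := SGraph line_sym line_irr.
End LineGraph.

(* The colour set Z_k is only used as a set of k colours; 'I_k has the right
   cardinality for every k, whereas 'Z_k does not for k < 2. *)
Definition colouring (k : nat) (G : sgraph) (f : G -> 'I_k) : Prop :=
  forall x y : G, adj x y -> f x != f y.

Definition bicoloured (k : nat) (G : sgraph) (f : G -> 'I_k) (i j : 'I_k) :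
  sgraph := induced [set x | (f x == i) || (f x == j)].

Definition star_colouring (k : nat) (G : sgraph) (f : G -> 'I_k) : Prop :=
  colouring f /\
  forall i j : 'I_k, i != j -> forall x : bicoloured f i j,
    exists q : nat, isomorphic (component x) (star q).

Definition distance_two_colouring (k : nat) (G : sgraph) (f : G -> 'I_k) :
  Prop :=
  colouring f /\
  forall i j : 'I_k, i != j -> forall x : bicoloured f i j,
    isomorphic (component x) (complete 1) \/
    isomorphic (component x) (complete 2).

Definition star_colourable (k : nat) (G : sgraph) : Prop :=
  exists f : G -> 'I_k, star_colouring f.

Definition distance_two_colourable (k : nat) (G : sgraph) : Prop :=
  exists f : G -> 'I_k, distance_two_colouring f.

(* Main.v *)
(* An edge colouring of a cubic graph with 4 colours leaves exactly one colour
   f(v) missing at every vertex v.  If the edge colouring is a star colouring,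
   then f is a distance-two colouring: otherwise some bicoloured path of length
   2 can be prolonged at both ends.  Moreover, f(u), f(v) and the colour of uv
   are distinct for every edge uv, so these together with the fourth colour form
   a permutation of the colours; its sign depends on u only, because the map
   f(v) |-> colour of uv is a derangement of three elements, and changes when
   u and v are exchanged, whence a bipartition.
   Conversely, for a distance-two colouring f and a bipartition (A, B), colour
   the edge ab by i such that (f(a), f(b), i, _) is an even permutation.
   A vertex on edges of both colours i, j has f-colour outside {i, j}, and a
   bicoloured path of length 4 has three inner vertices, which f would have to
   colour differently using the two remaining colours. *)
Require Import Defs.
From mathcomp Require Import all_boot.
Set Implicit Arguments.
Unset Strict Implicit.
Unset Printing Implicit Defensive.

(** * Counting in ['I_n], and isomorphisms *)

Lemma uniq_ord_size n (s : seq 'I_n) : uniq s -> size s <= n.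
Proof. by move=> /card_uniqP <-; rewrite -[leqRHS]card_ord max_card. Qed.

Lemma ex_ord_notin n (s : seq 'I_n) : size s < n -> exists i, i \notin s.
Proof.
move=> lt_s_n; apply/existsP; rewrite -negb_forall; apply: contraL lt_s_n.
move=> /forallP s_full; rewrite -leqNgt -[n in n <= _]card_ord.
by apply: leq_trans (card_size s); apply/subset_leq_card/subsetP => i _.
Qed.

Lemma isomorphic_sym (G H : sgraph) : isomorphic G H -> isomorphic H G.
Proof.
by case=> h [g hK gK] hadj; exists g => [|x y]; [exists h | rewrite -hadj !gK].
Qed.

Lemma isomorphic_complete (G : sgraph) :
  (forall x y : G, x != y -> adj x y) -> isomorphic G (complete #|G|).
Proof.
move=> complG; exists enum_rank => [|x y]; first exact: enum_rank_bij.
rewrite /= /complete_adj (inj_eq enum_rank_inj).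
by case: eqVneq => [->|/complG->]; rewrite ?adj_irr.
Qed.

(** * Star components and components of order at most two, in terms of short walks *)

Section Components.
Variable H : sgraph.
Implicit Types x y z c : H.

Lemma connect_adj_sym : connect_sym (@adj H).
Proof. by exact: sym_connect_sym (@adj_sym H). Qed.

Lemma closed_component x (S : {set H}) :
    x \in S -> {in S, forall y z, adj y z -> z \in S} ->
  [set y | connect (@adj H) x y] \subset S.
Proof.
move=> Sx closedS; apply/subsetP=> y; rewrite inE => /connectP[p + ->].
by elim: p x Sx => //= z p IHp x Sx /andP[/(closedS _ Sx)/IHp].
Qed.

(** The hypothesis excludes triangles as well as paths on four vertices, since [x3 = x0] is allowed.
    The centre is the middle of a path of length two starting at [x] if there is one, and [x] itself
    otherwise. *)
Lemma component_star x :
    (forall x0 x1 x2 x3, adj x0 x1 -> adj x1 x2 -> adj x2 x3 ->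
       x0 != x2 -> x1 = x3) ->
  exists q, isomorphic (component x) (star q).
Proof.
move=> noP4.
have [c xc hc]: exists2 c, connect (@adj H) x c &
    forall y z, adj c y -> adj y z -> z = c.
  have [/existsP[y /existsP[z /and3P[xy yz neq_zx]]] | noP3] :=
      boolP [exists y, exists z, [&& adj x y, adj y z & z != x]].
    exists y => [|w v yw wv]; first exact: connect1.
    apply/eqP/negPn/negP=> neq_vy; rewrite adj_sym in wv.
    rewrite adj_sym in yw; have zw := noP4 _ _ _ _ wv yw yz neq_vy.
    rewrite adj_sym in xy; have xw := noP4 _ _ _ _ wv yw xy neq_vy.
    by rewrite -zw -xw eqxx in neq_zx.
  exists x => // y z xy yz; apply: contraNeq noP3 => neq_zx.
  by apply/existsP; exists y; apply/existsP; exists z; apply/and3P.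
pose N := [set y | adj c y].
have NE (i : 'I_#|N|) : adj c (enum_val i) by have := enum_valP i; rewrite inE.
have cN : c \notin N by rewrite inE adj_irr.
have compE : [set y | connect (@adj H) x y] = c |: N.
  apply/eqP; rewrite eqEsubset; apply/andP; split.
    have -> : [set y | connect (@adj H) x y] = [set y | connect (@adj H) c y].
      by apply/setP=> y; rewrite !inE (same_connect connect_adj_sym xc).
    apply: closed_component => [|y]; first exact: setU11.
    rewrite !inE => /predU1P[->|cy] z yz; rewrite !inE.
      by rewrite yz orbT.
    by rewrite (hc y z) ?eqxx.
  apply/subsetP=> y; rewrite !inE => /predU1P[->//|cy].
  exact: connect_trans xc (connect1 cy).
exists #|N|; apply: isomorphic_sym.
have gP (o : option 'I_#|N|) :
    oapp enum_val c o \in [set y | connect (@adj H) x y].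
  by rewrite compE; case: o => [i|] /=; rewrite !inE ?eqxx // NE orbT.
pose g (o : star #|N|) : component x := Sub (oapp enum_val c o) (gP o).
exists g.
  apply: inj_card_bij => [o1 o2 /(congr1 val) /=|].
    case: o1 o2 => [i|] [j|] //=.
    - by move/enum_val_inj->.
    - by move=> ic; have := NE i; rewrite ic adj_irr.
    - by move=> ic; have := NE j; rewrite -ic adj_irr.
  by rewrite card_sig compE cardsU1 cN /= card_option card_ord.
case=> [i|] [j|]; rewrite /= /induced_adj /= /star_adj /=.
- apply/negP=> ij; have := NE j.
  by rewrite (hc _ _ (NE i) ij) adj_irr.
- by rewrite adj_sym NE.
- by rewrite NE.
- by rewrite adj_irr.
Qed.

(** Every edge of a star has exactly one end at the centre, so either [x0] and [x2], or [x1] and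
    [x3], are both mapped to it. *)
Lemma star_component_noP4 x q x0 x1 x2 x3 :
    isomorphic (component x) (star q) -> connect (@adj H) x x0 ->
    adj x0 x1 -> adj x1 x2 -> adj x2 x3 ->
  x0 != x2 -> x1 = x3.
Proof.
case=> h /bij_inj h_inj hadj xx0 x01 x12 x23.
have xx1 := connect_trans xx0 (connect1 x01).
have xx2 := connect_trans xx1 (connect1 x12).
have xx3 := connect_trans xx2 (connect1 x23).
have inC y : connect (@adj H) x y -> y \in [set y | connect (@adj H) x y].
  by rewrite inE.
pose v y (xy : connect (@adj H) x y) : component x := Sub y (inC y xy).
have := hadj (v _ xx0) (v _ xx1); have := hadj (v _ xx1) (v _ xx2).
have := hadj (v _ xx2) (v _ xx3); rewrite /= /induced_adj /= x01 x12 x23.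
rewrite /star_adj /= => h23 h12 h01 neq02.
case h0 : (h (v _ xx0)) h01 h12 h23 => [i|]; case h1 : (h (v _ xx1)) => [j|] //.
  case h2 : (h (v _ xx2)) => [k|] //; case h3 : (h (v _ xx3)) => [l|] // _ _ _.
  by have /h_inj/(congr1 val) : h (v _ xx1) = h (v _ xx3) by rewrite h1 h3.
case h2 : (h (v _ xx2)) => [k|] // _ _ _.
have /h_inj/(congr1 val) /= eq02 : h (v _ xx0) = h (v _ xx2) by rewrite h0 h2.
by rewrite eq02 eqxx in neq02.
Qed.

Lemma component_K1_K2 x :
    (forall x0 x1 x2, adj x0 x1 -> adj x1 x2 -> x0 = x2) ->
  isomorphic (component x) (complete 1) \/
  isomorphic (component x) (complete 2).
Proof.
move=> noP3; set C := [set y | connect (@adj H) x y].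
have Cx : x \in C by rewrite inE connect0.
have [C1 | [y xy Cxy]] : C = [set x] \/ exists2 y, adj x y & C = [set x; y].
  have [/existsP[y xy] | /existsPn isol] := boolP [exists y, adj x y].
    right; exists y => //; apply/eqP; rewrite eqEsubset subUset !sub1set Cx.
    rewrite [y \in C]inE connect1 // !andbT.
    apply: closed_component => [|u]; first exact: set21.
    rewrite !inE => /orP[]/eqP-> z uz; rewrite !inE.
      rewrite adj_sym in xy.
      by rewrite (noP3 _ _ _ xy uz) eqxx orbT.
    by rewrite (noP3 _ _ _ xy uz) eqxx.
  left; apply/eqP; rewrite eqEsubset sub1set Cx andbT.
  apply: closed_component => [|u]; first exact: set11.
  by rewrite inE => /eqP-> z xz; case/negP: (isol z).
- left; have <- : #|component x| = 1 by rewrite card_sig -/C C1 cards1.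
  apply: isomorphic_complete => -[u Cu] [v Cv].
  rewrite -val_eqE /= /induced_adj /=.
  by move: Cu Cv; rewrite -/C C1 !inE => /eqP-> /eqP->; rewrite eqxx.
- have neq_xy : x != y by apply: contraTneq xy => ->; rewrite adj_irr.
  right; have <- : #|component x| = 2 by rewrite card_sig -/C Cxy cards2 neq_xy.
  apply: isomorphic_complete => -[u Cu] [v Cv].
  rewrite -val_eqE /= /induced_adj /=.
  move: Cu Cv; rewrite -/C Cxy !inE.
  by move=> /orP[]/eqP-> /orP[]/eqP->; rewrite ?eqxx // adj_sym.
Qed.

Lemma complete_component_noP3 x n x0 x1 x2 :
    n <= 2 -> isomorphic (component x) (complete n) ->
    connect (@adj H) x x0 -> adj x0 x1 -> adj x1 x2 -> x0 = x2.
Proof.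
move=> le_n2 [h /bij_inj h_inj _] xx0 x01 x12.
have xx1 := connect_trans xx0 (connect1 x01).
have xx2 := connect_trans xx1 (connect1 x12).
have inC y : connect (@adj H) x y -> y \in [set y | connect (@adj H) x y].
  by rewrite inE.
pose v y (xy : connect (@adj H) x y) : component x := Sub y (inC y xy).
have := @uniq_ord_size n (map h [:: v _ xx0; v _ xx1; v _ xx2]).
rewrite map_inj_uniq //= !inE -!val_eqE /= => le3n.
apply/eqP; apply: contraTT le_n2 => neq02; rewrite -ltnNge; apply: le3n.
rewrite negb_or neq02 !andbT.
by apply/andP; split; [apply: contraTneq x01 | apply: contraTneq x12];
  move=> ->; rewrite adj_irr.
Qed.

End Components.

(** * Local criteria for both kinds of colouring *)

Section Bicoloured.
Variables (G : sgraph) (k : nat) (f : G -> 'I_k).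

(** An alternating walk stays inside one bicoloured component; conversely, properness forces walks
    in a bicoloured subgraph to alternate. *)
Lemma star_colouringP :
  star_colouring f <-> colouring f /\
    forall x0 x1 x2 x3 : G, adj x0 x1 -> adj x1 x2 -> adj x2 x3 ->
      f x0 = f x2 -> f x1 = f x3 -> x0 != x2 -> x1 = x3.
Proof.
split=> -[fcol fstar]; split=> //.
- move=> x0 x1 x2 x3 x01 x12 x23 f02 f13 neq02.
  have inB y : (f y == f x0) || (f y == f x1) ->
    y \in [set y | (f y == f x0) || (f y == f x1)] by rewrite inE.
  pose v y (By : (f y == f x0) || (f y == f x1)) : bicoloured f (f x0) (f x1) :=
    Sub y (inB y By).
  have B0 : (f x0 == f x0) || (f x0 == f x1) by rewrite eqxx.
  have B1 : (f x1 == f x0) || (f x1 == f x1) by rewrite eqxx orbT.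
  have B2 : (f x2 == f x0) || (f x2 == f x1) by rewrite f02 eqxx.
  have B3 : (f x3 == f x0) || (f x3 == f x1) by rewrite f13 eqxx orbT.
  have [q starq] := fstar _ _ (fcol _ _ x01) (v _ B0).
  have /(congr1 val) // : v _ B1 = v _ B3.
  exact: (star_component_noP4 (x2 := v _ B2) starq (connect0 _ _)).
- move=> i j _ x; apply: component_star => -[x0 B0] [x1 B1] [x2 B2] [x3 B3].
  rewrite /= /induced_adj /= -val_eqE /= => x01 x12 x23 neq02; apply: val_inj => /=.
  have := (fcol _ _ x01, fcol _ _ x12, fcol _ _ x23).
  move=> [[/eqP f01 /eqP f12] /eqP f23].
  rewrite !inE in B0 B1 B2 B3.
  apply: fstar neq02 => //;
   by move: B0 B1 B2 B3 => /orP[]/eqP ? /orP[]/eqP ? /orP[]/eqP ? /orP[]/eqP ?;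
    congruence.
Qed.

Lemma distance_two_colouringP :
  distance_two_colouring f <-> colouring f /\
    forall x0 x1 x2 : G, adj x0 x1 -> adj x1 x2 -> f x0 = f x2 -> x0 = x2.
Proof.
split=> -[fcol fdist]; split=> //.
- move=> x0 x1 x2 x01 x12 f02.
  have inB y : (f y == f x0) || (f y == f x1) ->
    y \in [set y | (f y == f x0) || (f y == f x1)] by rewrite inE.
  pose v y (By : (f y == f x0) || (f y == f x1)) : bicoloured f (f x0) (f x1) :=
    Sub y (inB y By).
  have B0 : (f x0 == f x0) || (f x0 == f x1) by rewrite eqxx.
  have B1 : (f x1 == f x0) || (f x1 == f x1) by rewrite eqxx orbT.
  have B2 : (f x2 == f x0) || (f x2 == f x1) by rewrite f02 eqxx.
  have /(congr1 val) // : v _ B0 = v _ B2.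
  by have [K|K] := fdist _ _ (fcol _ _ x01) (v _ B0);
    apply: (complete_component_noP3 (x1 := v _ B1) _ K (connect0 _ _)).
- move=> i j _ x; apply: component_K1_K2 => -[x0 B0] [x1 B1] [x2 B2].
  rewrite /= /induced_adj /= => x01 x12; apply: val_inj => /=.
  have := (fcol _ _ x01, fcol _ _ x12) => -[/eqP f01 /eqP f12].
  rewrite !inE in B0 B1 B2.
  apply: fdist x01 x12 _.
  by move: B0 B1 B2 => /orP[]/eqP ? /orP[]/eqP ? /orP[]/eqP ?; congruence.
Qed.

End Bicoloured.

(* The idempotent Latin square w^2 i + w j over the field {0, 1, w, w^2} with
   four elements; (i, j, lsq i j, _) is an even permutation when i != j. *)
Definition lsq_table : seq (seq nat) :=
  [:: [:: 0; 2; 3; 1]; [:: 3; 1; 0; 2]; [:: 1; 3; 2; 0]; [:: 2; 0; 1; 3]].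

Lemma lsq_subproof (i j : 'I_4) : nth 0 (nth [::] lsq_table i) j < 4.
Proof. by case: i j => [[|[|[|[|//]]]] ?] [[|[|[|[|//]]]] ?]. Qed.

Definition lsq (i j : 'I_4) : 'I_4 := Ordinal (lsq_subproof i j).

Lemma lsq_injr i : injective (lsq i).
Proof.
move=> j k /eqP lsq_jk; apply/eqP; move: lsq_jk.
by case: i j k => [[|[|[|[|//]]]] ?] [[|[|[|[|//]]]] ?] [[|[|[|[|//]]]] ?].
Qed.

Lemma lsq_injl j : injective (lsq^~ j).
Proof.
move=> i k /eqP lsq_ik; apply/eqP; move: lsq_ik.
by case: i j k => [[|[|[|[|//]]]] ?] [[|[|[|[|//]]]] ?] [[|[|[|[|//]]]] ?].
Qed.

Lemma lsqii i : lsq i i = i.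
Proof. by apply/eqP; case: i => [[|[|[|[|//]]]] ?]. Qed.

Lemma lsq_neql i j : i != j -> lsq i j != i.
Proof. by apply: contra => /eqP; rewrite -{2}(lsqii i) => /lsq_injr->. Qed.

Lemma lsq_neqr i j : i != j -> lsq i j != j.
Proof. by apply: contra => /eqP; rewrite -{2}(lsqii j) => /lsq_injl->. Qed.

(** [lsq i j] and [lsq j i] are the two colours other than [i] and [j]. This yields the change of
    sign when an edge is reversed. *)
Lemma lsq_swap i j a : i != j -> a != i -> a != j ->
  (a == lsq j i) = (a != lsq i j).
Proof.
by case: i j a => [[|[|[|[|//]]]] ?] [[|[|[|[|//]]]] ?] [[|[|[|[|//]]]] ?].
Qed.

(** For fixed [i], [lsq i] acts on the other three colours as a 3-cycle s. Say a = s(j) and a' =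
    s^-1(j'). Then j' = s^-1(j) would give a' = s(j) = a, so j' = s(j) = a and a' = j. The other
    case is symmetric. *)
Lemma lsq_parity i j j' a a' :
    i != j -> a != i -> a != j -> i != j' -> a' != i -> a' != j' -> j != j' ->
    (a == lsq i j) != (a' == lsq i j') -> a != a' ->
  a = j' /\ a' = j.
Proof.
move=> ij ai aj ij' ai' aj' jj' p aa'; suff: (a == j') && (a' == j).
  by case/andP=> /eqP ? /eqP.
case: i j a ij ai aj ij' ai' jj' aa' p => [[|[|[|[|//]]]] ?] [[|[|[|[|//]]]] ?] //;
case=> [[|[|[|[|//]]]] ?] //= _ _ _;
by case: j' a' aj' => [[|[|[|[|//]]]] ?] [[|[|[|[|//]]]] ?].
Qed.

(** * Edges as vertices of the line graph *)

Section LineGraph.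
Variable G : sgraph.
Implicit Types (u v w : G) (E F : line_graph G).

Lemma adj_neq u v : adj u v -> u != v.
Proof. by apply: contraTneq => ->; rewrite adj_irr. Qed.

Lemma edgeP E v : v \in val E -> exists2 w, adj v w & val E = [set v; w].
Proof.
have := valP E; rewrite inE => /existsP[x /existsP[y /andP[xy /eqP->]]].
rewrite !inE => /orP[]/eqP->; first by exists y.
by exists x; rewrite 1?adj_sym // setUC.
Qed.

Lemma edge_proof u v : adj u v -> [set u; v] \in edges G.
Proof.
by move=> uv; rewrite inE; apply/existsP; exists u; apply/existsP; exists v;
  rewrite uv eqxx.
Qed.

Lemma edge2 E u v : u \in val E -> v \in val E -> u != v ->
  adj u v /\ val E = [set u; v].
Proof.
case/edgeP=> w uw ->; rewrite !inE => /orP[]/eqP->; first by rewrite eqxx.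
by [].
Qed.

Lemma line_adjP E F : reflect (E != F /\ exists v, v \in val E /\ v \in val F)
  (adj E F).
Proof.
apply: (iffP andP) => -[neqEF].
  by case/set0Pn=> v; rewrite inE => /andP[]; split=> //; exists v.
case=> v [vE vF]; split=> //; apply/set0Pn; exists v.
by rewrite inE vE vF.
Qed.

Lemma eq_set2l u v w : u != w -> [set u; v] = [set u; w] -> v = w.
Proof.
move=> neq_uw /setP/(_ w); rewrite !inE eqxx orbT eq_sym (negbTE neq_uw).
by move/eqP.
Qed.

End LineGraph.

(** * From a bipartition and a distance-two colouring to a star colouring of the edges *)

Section StarOfDistanceTwo.
Variables (G : sgraph) (A : {set G}) (f : G -> 'I_4).
Hypothesis bipA : forall x y : G, adj x y -> (x \in A) != (y \in A).
Hypothesis fcol : colouring f.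
Hypothesis fdist :
  forall x0 x1 x2 : G, adj x0 x1 -> adj x1 x2 -> f x0 = f x2 -> x0 = x2.

(** The pick orders the ends of [E] with the one in [A] first. By [bipA] there is exactly one
    choice, so the default [ord0] never occurs. *)
Definition edge_colour (E : line_graph G) : 'I_4 :=
  if [pick p : G * G | (p.1 \in A) && (p.1 \in val E) && (p.2 \in val E :\ p.1)]
    is Some p then lsq (f p.1) (f p.2) else ord0.

Lemma edge_colourE (E : line_graph G) u v : adj u v -> val E = [set u; v] ->
  edge_colour E = if u \in A then lsq (f u) (f v) else lsq (f v) (f u).
Proof.
move=> uv EE; have neq_uv := adj_neq uv; have := bipA uv.
rewrite /edge_colour; case: pickP => [[x y] /=|].
  rewrite EE !inE => /andP[/andP[Ax xuv] /andP[neq_yx yuv]].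
  by case/orP: xuv Ax yuv neq_yx => /eqP-> + /orP[]/eqP->;
     rewrite ?eqxx //; case: (u \in A); case: (v \in A).
case Au: (u \in A); case Av: (v \in A) => // no _.
  by have := no (u, v); rewrite /= EE !inE !eqxx Au [v == u]eq_sym neq_uv orbT.
by have := no (v, u); rewrite /= EE !inE !eqxx Av neq_uv orbT.
Qed.

Lemma edge_colour_neq (E : line_graph G) v : v \in val E -> edge_colour E != f v.
Proof.
case/edgeP=> w vw EE; rewrite (edge_colourE vw EE).
have fvw := fcol vw; case: ifP => _; first exact: lsq_neql.
by rewrite lsq_neqr // eq_sym.
Qed.

(** Rows and columns of the Latin square are injective, so two edges of one colour at [v] have far
    ends with the same [f], which [fdist] identifies. *)
Lemma edge_colour_proper : colouring edge_colour.
Proof.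
move=> E F /line_adjP[neqEF [v [/edgeP[x vx Ex] /edgeP[y vy Ey]]]].
rewrite (edge_colourE vx Ex) (edge_colourE vy Ey).
apply: contra neqEF => /eqP eq_xy; rewrite -val_eqE /= Ex Ey; apply/eqP.
suff -> : x = y by [].
rewrite adj_sym in vx; apply: fdist vx vy _.
by case: ifP eq_xy => _; [apply: lsq_injr | apply: lsq_injl].
Qed.

Lemma edge_colour_star : star_colouring edge_colour.
Proof.
apply/star_colouringP; split=> [|E0 E1 E2 E3]; first exact: edge_colour_proper.
move=> adj01 adj12 adj23 eq02 eq13 neq02; apply/eqP/negPn/negP => neq13.
have := edge_colour_proper adj12.
have [_ [v1 [v1E0 v1E1]]] := line_adjP _ _ adj01.
have [neq12 [v2 [v2E1 v2E2]]] := line_adjP _ _ adj12.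
have [_ [v3 [v3E2 v3E3]]] := line_adjP _ _ adj23.
have share (E F : line_graph G) v : v \in val E -> v \in val F ->
    edge_colour E = edge_colour F -> E != F -> False.
  move=> vE vF eqEF neqEF; suff /edge_colour_proper : adj E F by rewrite eqEF eqxx.
  by apply/line_adjP; split=> //; exists v.
have neq_v12 : v1 != v2.
  (* Otherwise the equally coloured edges [E0] and [E2] would meet. *)
  by apply/eqP => eq12; rewrite eq12 in v1E0; apply: (share _ _ _ v1E0 v2E2).
have neq_v23 : v2 != v3.
  by apply/eqP => eq23; rewrite -eq23 in v3E3; apply: (share _ _ _ v2E1 v3E3).
have [adj_v12 E1E] := edge2 v1E1 v2E1 neq_v12.
have [adj_v23 E2E] := edge2 v2E2 v3E2 neq_v23.
have neq_v13 : v1 != v3.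
  by apply: contra neq12 => /eqP eq_v; rewrite -val_eqE /= E1E E2E eq_v setUC.
have f13 : f v1 != f v3 by apply: contra neq_v13 => /eqP/(fdist adj_v12 adj_v23)->.
(* These five elements of ['I_4] turn out to be distinct, a contradiction. *)
have := @uniq_ord_size 4 [:: edge_colour E1; edge_colour E2; f v1; f v2; f v3].
rewrite /= !inE !negb_or => too_many neq_c12.
have: false; last by []; apply: too_many.
rewrite f13 (fcol adj_v12) (fcol adj_v23) neq_c12.
rewrite (edge_colour_neq v1E1) (edge_colour_neq v2E1).
rewrite (edge_colour_neq v2E2) (edge_colour_neq v3E2).
(* [v1] is not on [E2], but it is on [E0], which has the same colour; likewise for [v3] with [E1]
   and [E3]. *)
by rewrite -eq02 (edge_colour_neq v1E0) eq13 (edge_colour_neq v3E3).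
Qed.

End StarOfDistanceTwo.

(** * From a star colouring of the edges to a distance-two colouring and a bipartition *)

Section DistanceTwoOfStar.
Variables (G : sgraph) (c : line_graph G -> 'I_4).
Hypothesis hG : regular 3 G.
Hypothesis ccol : colouring c.
Hypothesis cstar : forall E0 E1 E2 E3 : line_graph G,
  adj E0 E1 -> adj E1 E2 -> adj E2 E3 -> c E0 = c E2 -> c E1 = c E3 ->
  E0 != E2 -> E1 = E3.
Implicit Types u v w x y : G.

Definition col u v : 'I_4 :=
  if insub [set u; v] is Some E then c E else ord0.

Lemma colE u v (uv : adj u v) : col u v = c (Sub [set u; v] (edge_proof uv)).
Proof. by rewrite /col (insubT (fun E => E \in edges G) (edge_proof uv)). Qed.

Lemma colC u v : col u v = col v u.
Proof. by rewrite /col setUC. Qed.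

Lemma line_adj_edge u v w (uv : adj u v) (vw : adj v w) : u != w ->
  adj (Sub [set u; v] (edge_proof uv) : line_graph G)
      (Sub [set v; w] (edge_proof vw)).
Proof.
move=> neq_uw; apply/line_adjP; split; last by exists v; rewrite !inE !eqxx orbT.
rewrite -val_eqE /=; apply: contra neq_uw => /eqP; rewrite setUC.
by move/(eq_set2l (adj_neq vw))->.
Qed.

Lemma col_inj v u w : adj v u -> adj v w -> col v u = col v w -> u = w.
Proof.
move=> vu vw; rewrite colC; rewrite adj_sym in vu.
rewrite (colE vu) (colE vw) => eq_col; apply/eqP/negPn/negP=> neq_uw.
by have := ccol (line_adj_edge vu vw neq_uw); rewrite eq_col eqxx.
Qed.

(** This is [cstar] along a walk. Only backtracking is excluded: [v0 = v4] is allowed, so bicoloured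
    4-cycles are covered too. *)
Lemma col_trail v0 v1 v2 v3 v4 :
    adj v0 v1 -> adj v1 v2 -> adj v2 v3 -> adj v3 v4 ->
    v0 != v2 -> v1 != v3 -> v2 != v4 ->
  col v0 v1 = col v2 v3 -> col v1 v2 = col v3 v4 -> False.
Proof.
move=> e01 e12 e23 e34 neq02 neq13 neq24.
rewrite (colE e01) (colE e12) (colE e23) (colE e34) => c02 c13.
have diag x y z t : adj y z -> x != z -> [set x; y] != [set z; t].
  move=> yz neq_xz; apply/eqP=> /setP/(_ z).
  by rewrite !inE eqxx eq_sym (negbTE neq_xz) eq_sym (negbTE (adj_neq yz)).
have /(congr1 val) /eqP := cstar (line_adj_edge e01 e12 neq02)
  (line_adj_edge e12 e23 neq13) (line_adj_edge e23 e34 neq24) c02 c13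
  (diag _ _ _ _ e12 neq02).
by rewrite /= (negbTE (diag _ _ _ _ e23 neq13)).
Qed.

Definition missing v : 'I_4 :=
  odflt ord0 [pick i | i \notin col v @: [set w | adj v w]].

(** The three edges at [v] have distinct colours by [col_inj], so exactly one of the four colours is
    left; the default in [missing] is never taken. *)
Lemma mem_colours v i : (i \in col v @: [set w | adj v w]) = (i != missing v).
Proof.
set S := col v @: _.
have cardS : #|~: S| = 1.
  apply/eqP; rewrite -(eqn_add2l #|S|) cardsC card_ord card_in_imset ?hG //.
  by move=> u w; rewrite !inE; apply: col_inj.
have /cards1P[j Sj] : #|~: S| == 1 by rewrite cardS.
have SE k : (k \in S) = (k != j) by rewrite -[k \in S]negbK -in_setC Sj inE.
rewrite /missing -/S; case: pickP => [k|none]; first by rewrite !SE negbK => /eqP->.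
by have := none j; rewrite SE eqxx.
Qed.

Lemma missingP v i : i != missing v -> exists2 w, adj v w & col v w = i.
Proof. by rewrite -mem_colours => /imsetP[w]; rewrite inE => vw ->; exists w. Qed.

Lemma col_neq_missingl v w : adj v w -> col v w != missing v.
Proof. by move=> vw; rewrite -mem_colours; apply: imset_f; rewrite inE. Qed.

Lemma col_neq_missingr v w : adj v w -> col v w != missing w.
Proof. by rewrite adj_sym colC; apply: col_neq_missingl. Qed.

(** Otherwise the path can be prolonged at [v1] by the colour of its second edge and at [v3] by that
    of its first, against [col_trail]. *)
Lemma missing_path v1 v2 v3 : adj v1 v2 -> adj v2 v3 -> v1 != v3 ->
  missing v1 = col v2 v3 \/ missing v3 = col v1 v2.
Proof.
move=> e12 e23 neq13.
have [->|/missingP[v0 e10 c10]] := eqVneq (col v2 v3) (missing v1); first by left.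
have [->|/missingP[v4 e34 c34]] := eqVneq (col v1 v2) (missing v3); first by right.
have neqc : col v1 v2 != col v2 v3.
  apply: contra neq13 => /eqP; rewrite colC => eqc.
  by rewrite adj_sym in e12; rewrite (col_inj e12 e23 eqc).
have neq02 : v0 != v2 by apply: contra neqc => /eqP eq02; rewrite -c10 eq02.
have neq24 : v2 != v4 by apply: contra neqc => /eqP eq24; rewrite -c34 -eq24 colC.
rewrite adj_sym in e10; rewrite colC in c10.
by case: (col_trail e10 e12 e23 e34).
Qed.

Lemma missing_distance_two x0 x1 x2 :
  adj x0 x1 -> adj x1 x2 -> missing x0 = missing x2 -> x0 = x2.
Proof.
move=> e01 e12 eq_m; apply/eqP/negPn/negP=> neq02.
case: (missing_path e01 e12 neq02) => eq_c.
  by have := col_neq_missingr e12; rewrite -eq_m eq_c eqxx.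
by have := col_neq_missingl e01; rewrite eq_m eq_c eqxx.
Qed.

(** If [u] and [v] miss the same colour, [missing_path] makes the other two neighbours of [u] both
    miss the colour of [uv], so they coincide by [missing_distance_two]. *)
Lemma missing_proper : colouring missing.
Proof.
move=> u v uv; apply/eqP=> eq_m; pose a := col u v.
have [i] := @ex_ord_notin 4 [:: a; missing u] isT.
have [j] := @ex_ord_notin 4 [:: a; missing u; i] isT.
rewrite !inE !negb_or => /and3P[ja jm ji] /andP[ia im].
have far k w : k != a -> k != missing u -> adj u w -> col u w = k ->
    missing w = a.
  move=> ka km uw cw.
  have neq_wv : w != v by apply: contra ka => /eqP eq_wv; rewrite -cw eq_wv.
  have wu : adj w u by rewrite adj_sym.
  case: (missing_path wu uv neq_wv) => // eq_k.
  by rewrite eq_m eq_k colC cw eqxx in km.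
have [[w uw cw] [x ux cx]] := (missingP im, missingP jm).
have eq_wx : missing w = missing x by rewrite (far _ _ ia im) // (far _ _ ja jm).
rewrite adj_sym in uw; have eqwx := missing_distance_two uw ux eq_wx.
by rewrite -cw -cx eqwx eqxx in ji.
Qed.

(** For adjacent [u] and [v], this is the sign of the permutation given by [missing u], [missing v],
    [col u v] and the fourth colour. *)
Definition even_edge u v := col u v == lsq (missing u) (missing v).

Lemma even_edge_swap u v : adj u v -> even_edge v u = ~~ even_edge u v.
Proof.
move=> uv; rewrite /even_edge colC lsq_swap ?col_neq_missingl //.
- exact: missing_proper.
- exact: col_neq_missingr.
Qed.

(** With opposite signs, [lsq_parity] shows that the edges to [v] and [w] exchange colours and
    missing colours. The third neighbour of [u] would then have to miss the colour of its own edge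
    to [u]. *)
Lemma even_edge_const u v w : adj u v -> adj u w -> even_edge u v = even_edge u w.
Proof.
move=> uv uw; have [->//|neq_vw] := eqVneq v w.
apply: contraTeq isT => neq_even.
have vu : adj v u by rewrite adj_sym.
have wu : adj w u by rewrite adj_sym.
have mvw : missing v != missing w.
  by apply: contra neq_vw => /eqP/(missing_distance_two vu uw)->.
have cvw : col u v != col u w by apply: contra neq_vw => /eqP/(col_inj uv uw)->.
have [cv cw] := lsq_parity (missing_proper uv) (col_neq_missingl uv)
  (col_neq_missingr uv) (missing_proper uw) (col_neq_missingl uw)
  (col_neq_missingr uw) mvw neq_even cvw.
(* [i] is the colour of the third edge at [u]. *)
have [i] := @ex_ord_notin 4 [:: missing u; missing v; missing w] isT.
rewrite !inE !negb_or => /and3P[iu iv iw].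
have [x ux cx] := missingP iu.
have mx y : adj y u -> i != col u y -> missing x != missing y.
  move=> yu; apply: contra => /eqP/esym/(missing_distance_two yu ux)->.
  by rewrite cx.
(* The first and last three entries exhaust the colours, and [missing x] differs from each. *)
have := @uniq_ord_size 4 [:: i; missing x; missing u; missing v; missing w].
rewrite /= !inE !negb_or => too_many.
have: false; last by []; apply: too_many.
rewrite iu iv iw mvw !(missing_proper uv, missing_proper uw) -{1}cx.
rewrite (col_neq_missingr ux) (mx v) ?cv // (mx w) ?cw //.
by rewrite missing_proper // adj_sym.
Qed.

Lemma star_bipartite : bipartite G.
Proof.
(* By [even_edge_const], a single edge at [u] decides membership. *)
exists [set u | [exists v, adj u v && even_edge u v]] => u v uv; rewrite !inE.
have evenE x y : adj x y -> [exists z, adj x z && even_edge x z] = even_edge x y.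
  move=> xy; apply/existsP/idP => [[z /andP[xz]]|exy].
    by rewrite (even_edge_const xz xy).
  by exists y; rewrite xy.
rewrite (evenE u v uv) (evenE v u); last by rewrite adj_sym.
by rewrite (even_edge_swap uv); case: even_edge.
Qed.

End DistanceTwoOfStar.

Theorem theorem11 (G : sgraph) (hG : regular 3 G) :
  star_colourable 4 (line_graph G) <->
  bipartite G /\ distance_two_colourable 4 G.
Proof.
split=> [[c /star_colouringP[ccol cstar]] | [[A bipA] [f]]].
  split; first exact: star_bipartite ccol cstar.
  exists (missing c); apply/distance_two_colouringP; split.
    exact: missing_proper.
  exact: missing_distance_two.
case/distance_two_colouringP=> fcol fdist.
by exists (edge_colour A f); apply: edge_colour_star.
Qed.
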